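(* There exist a simplicial $3$-sphere $K$ and a nondegenerate simplicial map $f\colon K\to X(\mathbb Z_2^4)$ which is surjective on facets, i.e. every facet of $X(\mathbb Z_2^4)$ is the image under $f$ of some facet of $K$.
   Context: $\mathbb Z_2=\mathbb Z/2\mathbb Z$. $X(\mathbb Z_2^4)$ is the simplicial complex whose vertices are the $15$ nonzero vectors of $\mathbb Z_2^4$ and whose simplices are the linearly independent subsets of $\mathbb Z_2^4$; its facets (maximal simplices) are the bases of $\mathbb Z_2^4$. A simplicial $3$-sphere is a (finite, abstract) simplicial complex whose geometric realization is homeomorphic to $S^3$. A simplicial map is nondegenerate if it is injective on each simplex. *)

(* Defs.v *)
From HB Require Import structures.
From mathcomp Require Import all_boot all_order all_algebra.
From mathcomp Require Import all_classical reals topology normedtype.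

Set Implicit Arguments.
Unset Strict Implicit.
Unset Printing Implicit Defensive.

Import Order.TTheory GRing.Theory Num.Theory.
Import numFieldNormedType.Exports.

Local Open Scope ring_scope.

(* Finite abstract simplicial complexes on a ground set V. Elements of V need
   not all be vertices: v is a vertex exactly when [set v] is a simplex. *)
Record simplicial_complex (V : finType) := SimplicialComplex {
  simplices :> {set {set V}};
  simplices0 : finset.set0 \in simplices;
  simplices_sub : forall s t : {set V},
    s \in simplices -> t \subset s -> t \in simplices }.

Definition vertices (V : finType) (K : simplicial_complex V) : {set V} :=
  [set v | [set v]%SET \in simplices K]%SET.

Definition facet (V : finType) (K : simplicial_complex V) (s : {set V}) : bool :=
  maxset (fun t => t \in simplices K) s.

(* Only the values of f on the vertices of K matter below. *)
Definition simplicial_map (V W : finType) (K : simplicial_complex V)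
    (L : simplicial_complex W) (f : V -> W) : Prop :=
  forall s : {set V}, s \in simplices K -> f @: s \in simplices L.

Definition nondegenerate_map (V W : finType) (K : simplicial_complex V)
    (f : V -> W) : Prop :=
  forall s : {set V}, s \in simplices K -> {in s &, injective f}.

Definition surjective_on_facets (V W : finType) (K : simplicial_complex V)
    (L : simplicial_complex W) (f : V -> W) : Prop :=
  forall t : {set W}, facet L t -> exists2 s : {set V}, facet K s & f @: s = t.

Section LinearlyIndependentSets.
Variable n : nat.

Definition indep_sets : {set {set 'rV['F_2]_n}} :=
  [set s : {set 'rV['F_2]_n} | free (enum s)]%SET.

Lemma indep_sets0 : finset.set0 \in indep_sets.
Proof. by rewrite inE enum_set0 nil_free. Qed.

Lemma indep_sets_sub (s t : {set 'rV['F_2]_n}) :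
  s \in indep_sets -> t \subset s -> t \in indep_sets.
Proof.
rewrite !inE => s_free /fintype.subsetP ts.
suff -> : enum t = [seq v <- enum s | v \in t] by exact: filter_free.
rewrite /enum_mem -filter_predI; apply: eq_filter => v /=.
by case: (boolP (v \in t)) => //= /ts ->.
Qed.

(* X(Z_2^n) *)
Definition XZ2 : simplicial_complex 'rV['F_2]_n :=
  SimplicialComplex indep_sets0 indep_sets_sub.

Lemma vertices_XZ2 : vertices XZ2 = [set v | v != 0]%SET.
Proof. by apply/setP => v; rewrite !inE enum_set1 seq1_free. Qed.

End LinearlyIndependentSets.

(* Barycentric coordinates: points of R^V, with the product topology, whose
   coordinates are nonnegative, sum to 1, and are supported on a simplex. *)
Definition realization (R : realType) (V : finType) (K : simplicial_complex V) :
    set {ptws V -> R} :=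
  [set x : {ptws V -> R} | [/\ forall v, 0 <= x v, \sum_v x v = 1 &
     [set v | x v != 0]%SET \in simplices K]]%classic.
Arguments realization R {V} K.

Definition sphere (R : realType) (n : nat) : set 'rV[R]_n.+1 :=
  [set x : 'rV[R]_n.+1 | \sum_i x ord0 i ^+ 2 = 1]%classic.
Arguments sphere R n : clear implicits.

Definition homeomorphic (X Y : topologicalType) : Prop :=
  exists (f : X -> Y) (g : Y -> X),
    [/\ cancel f g, cancel g f, continuous f & continuous g].

(* set_type carries the subspace topology. *)
Definition simplicial_sphere (R : realType) (n : nat) (V : finType)
    (K : simplicial_complex V) : Prop :=
  homeomorphic (set_type (realization R K)) (set_type (sphere R n)).

(* Main.v *)
Require Import Defs.
From mathcomp Require Import all_boot all_order all_algebra.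
From mathcomp Require Import all_classical reals topology normedtype.
From mathcomp Require Import realfun.
From mathcomp Require Import fintype finset.

(** The proof starts from a small labelled sphere and refines it by stellar
subdivisions until every basis of Z_2^n has appeared.

Call a map f from the vertices of K to Z_2^n a labelling if the labels of the
vertices of any nonempty simplex have a nonzero sum. Over Z_2 this is linear
independence of the labels together with their being distinct, so labellings
are the nondegenerate simplicial maps K -> X(Z_2^n) ([labelling_inj],
[labelling_simplicial]). Let the stellar subdivision of K at a simplex sigma
give its new vertex the sum of the labels of sigma. A simplex through the new
vertex then has label sum equal to that of a symmetric difference of two faces
of one simplex of K, hence nonzero: labellings survive ([stellar_labelling]).
The realization survives too, through an explicit piecewise linear
homeomorphism ([stellar_homeomorphic]).

It remains to choose the subdivisions. Let s be a simplex whose labels form a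
basis, I a subset of s, and a, b distinct elements of I. Three subdivisions,
which change nothing outside s, make the basis obtained from that of s by
trading the label of b for the sum x of the labels of I appear, and keep all
the earlier ones ([add_exchanged_basis]):
- subdividing s, which creates a vertex m labelled by the sum over s;
- subdividing m together with s minus I, which creates a vertex u labelled x,
  and s with b replaced by u is now a simplex;
- subdividing u together with I minus a, which creates a vertex labelled like
  a; substituting it for a in s restores the basis that was destroyed.
The Steinitz exchange lemma leads from any basis to any other through such
trades ([cover_facet]), and there are finitely many bases.

The starting sphere is the boundary of the cross-polytope, with the vertices
e_i and -e_i both labelled by the i-th basis vector. *)

Set Implicit Arguments.
Unset Strict Implicit.
Unset Printing Implicit Defensive.

Import Order.TTheory GRing.Theory Num.Theory.
Import numFieldNormedType.Exports.

(** * Homeomorphisms between subspaces *)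

Section Homeomorphisms.
Local Open Scope classical_set_scope.

Lemma homeomorphic_trans (X Y Z : topologicalType) :
  homeomorphic X Y -> homeomorphic Y Z -> homeomorphic X Z.
Proof.
move=> [f [f' [fK f'K f_cont f'_cont]]] [g [g' [gK g'K g_cont g'_cont]]].
exists (g \o f), (f' \o g'); split.
- exact: can_comp gK fK.
- exact: can_comp f'K g'K.
- by move=> x; exact: continuous_comp (f_cont _) (g_cont _).
- by move=> x; exact: continuous_comp (g'_cont _) (f'_cont _).
Qed.

(** Both maps are given on the ambient spaces and have to be continuous there
    only at the points of A and B: normalizations, which are discontinuous at
    the origin, are the intended use. *)
Lemma homeomorphic_set_type (X Y : topologicalType) (A : set X) (B : set Y)
    (f : X -> Y) (g : Y -> X) :
  (forall x, A x -> B (f x)) -> (forall y, B y -> A (g y)) ->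
  (forall x, A x -> g (f x) = x) -> (forall y, B y -> f (g y) = y) ->
  {in A, continuous f} -> {in B, continuous g} ->
  homeomorphic (classical_sets.set_type A) (classical_sets.set_type B).
Proof.
move=> fA gB fK gK /continuous_in_subspaceT/subspace_sigL_continuousP f_cont.
move=> /continuous_in_subspaceT/subspace_sigL_continuousP g_cont.
pose F (x : A) : B := SigSub (mem_set (fA _ (set_valP x))).
pose G (y : B) : A := SigSub (mem_set (gB _ (set_valP y))).
exists F, G; split.
- by move=> x; apply: val_inj; apply: fK; exact: set_valP.
- by move=> y; apply: val_inj; apply: gK; exact: set_valP.
- exact: (@continuous_comp_initial _ _ _ set_val F).
- exact: (@continuous_comp_initial _ _ _ set_val G).
Qed.

Lemma continuous_ptws (T U : topologicalType) (V : Type)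
    (F : T -> {ptws V -> U}) (t : T) :
  (forall v, {for t, continuous (fun s => F s v)}) -> {for t, continuous F}.
Proof.
move=> F_cont; apply/cvg_sup => v.
move=> O [? [[W W_open <-]]] WFt /filterS; apply; apply: (F_cont v).
exact: open_nbhs_nbhs.
Qed.

Lemma ptws_eval_continuous (R : realType) (V : finType) (v : V) :
  continuous (fun x : {ptws V -> R} => x v).
Proof. exact: (@proj_continuous V (fun=> R) v). Qed.

Lemma continuous_rV (T : topologicalType) (K : numFieldType) n
    (F : T -> 'rV[K]_n) (t : T) :
  (forall j, {for t, continuous (fun s => F s ord0 j)}) ->
  {for t, continuous F}.
Proof.
move=> F_cont U [P FP sPU]; rewrite /nbhs /=.
suff: \forall s \near t, forall i j, P i j (F s i j).
  by apply: filterS => s Ps; apply: sPU => i j; exact: Ps.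
apply: filter_forall => i; apply: filter_forall => j.
by rewrite (ord1 i); apply: F_cont; exact: FP.
Qed.
End Homeomorphisms.

(** * Stellar subdivisions *)

Section StellarSubdivision.
Local Open Scope ring_scope.
Variables (V : finType) (K : simplicial_complex V) (sigma : {set V}).

(** [None] is the new vertex. Both kinds of simplices of a stellar subdivision
    are treated at once: the simplices of K that do not contain sigma, and the
    joins of [None] with those of them whose union with sigma lies in K. *)
Definition stellar_simplices : {set {set option V}} :=
  [set s : {set option V} | ~~ (sigma \subset Some @^-1: s) &&
     ((if None \in s then Some @^-1: s :|: sigma else Some @^-1: s)
        \in simplices K)].

Hypothesis sigma_neq0 : sigma != set0.

Lemma stellar_simplices0 : set0 \in stellar_simplices.
Proof.
by rewrite inE inE preimset0 subset0 sigma_neq0 simplices0.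
Qed.

Lemma stellar_simplices_sub (s t : {set option V}) :
  s \in stellar_simplices -> t \subset s -> t \in stellar_simplices.
Proof.
rewrite !inE => /andP[sNsigma Ks] ts.
have ts' : Some @^-1: t \subset Some @^-1: s := preimsetS _ ts.
rewrite (contra (fun h => subset_trans h ts') sNsigma) /=.
case: ifPn => [t_None|_].
  rewrite (subsetP ts _ t_None) in Ks.
  by apply: (simplices_sub Ks); exact: setSU.
case: ifP Ks => _ Ks; apply: (simplices_sub Ks) => //.
exact: subset_trans ts' (subsetUl _ _).
Qed.

Definition stellar : simplicial_complex (option V) :=
  SimplicialComplex stellar_simplices0 stellar_simplices_sub.

Lemma preim_Some (s : {set V}) : Some @^-1: (Some @: s) = s.
Proof. by apply/setP => v; rewrite inE mem_imset // => x y []. Qed.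

Lemma None_notin_imset (s : {set V}) : (None \in Some @: s) = false.
Proof. by apply/imsetP => -[]. Qed.

Lemma stellar_old (s : {set V}) :
  s \in simplices K -> ~~ (sigma \subset s) -> Some @: s \in simplices stellar.
Proof. by move=> Ks sNsigma; rewrite inE None_notin_imset preim_Some sNsigma. Qed.

Lemma stellar_new (s : {set V}) (v : V) :
  s \in simplices K -> sigma \subset s -> v \in sigma ->
  None |: Some @: (s :\ v) \in simplices stellar.
Proof.
move=> Ks sigma_s v_sigma; rewrite inE setU11.
have -> : Some @^-1: (None |: Some @: (s :\ v)) = s :\ v.
  by rewrite preimsetU preim_Some; apply/setP => x; rewrite !inE.
apply/andP; split.
  by apply/subsetPn; exists v; rewrite ?setD11.
apply: simplices_sub Ks _.
by rewrite subUset sigma_s subD1set.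
Qed.

Variable R : realType.

Lemma sum_option (F : option V -> R) :
  \sum_v F v = F None + \sum_v F (Some v).
Proof.
rewrite (bigD1 None) //=; congr (_ + _).
rewrite (reindex_omap Some id) /=; last by case.
by apply: eq_bigl => v; rewrite eqxx.
Qed.

Let k : R := #|sigma|%:R.
Let k_neq0 : k != 0. Proof. by rewrite pnatr_eq0 cards_eq0. Qed.

(** The new vertex sits at the barycenter of sigma: its weight is shared equally
    among the vertices of sigma. *)
Definition stellar_collapse (c : {ptws option V -> R}) : {ptws V -> R} :=
  fun v => c (Some v) + c None / k * (v \in sigma)%:R.

(** On the realization, weights are at most 1, so the default value 1 does not
    affect the minimum. *)
Definition least_weight (x : V -> R) : R := \big[Order.min/1]_(v in sigma) x v.

(** The inverse of [stellar_collapse]: as much weight as possible is taken away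
    equally from the vertices of sigma and handed to the new vertex. *)
Definition stellar_lift (x : {ptws V -> R}) : {ptws option V -> R} :=
  fun o => if o is Some v then x v - least_weight x * (v \in sigma)%:R
           else k * least_weight x.

Lemma sum_mem_sigma (a : R) : \sum_v a * (v \in sigma)%:R = a * k.
Proof. by rewrite -mulr_sumr -natr_sum -big_mkcond /= sum1_card. Qed.

Lemma realization_le1 (W : finType) (L : simplicial_complex W) x (v : W) :
  realization R L x -> x v <= 1.
Proof.
by case=> x_ge0 <- _; rewrite (bigD1 v) //= lerDl sumr_ge0.
Qed.

Lemma least_weightP x : realization R K x ->
  exists2 v, v \in sigma & least_weight x = x v.
Proof.
move=> Kx; have /set0Pn[v0 v0_sigma] := sigma_neq0.
have [v v_sigma muE] :=
  eq_bigmin v0 _ _ v0_sigma (fun v _ => realization_le1 v Kx).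
by exists v => //; exact: muE.
Qed.

Lemma least_weight_le x v : v \in sigma -> least_weight x <= x v.
Proof. by move=> v_sigma; exact: Order.TotalTheory.bigmin_le_cond. Qed.

Lemma least_weight_ge0 x : realization R K x -> 0 <= least_weight x.
Proof. by move=> Kx; have [v _ ->] := least_weightP Kx; case: Kx. Qed.

Lemma stellar_collapse_realization c :
  realization R stellar c -> realization R K (stellar_collapse c).
Proof.
case=> c_ge0 c_sum c_supp.
have k_ge0 : 0 <= k by rewrite ler0n.
split.
- by move=> v; rewrite /stellar_collapse addr_ge0 ?mulr_ge0 ?invr_ge0 ?ler0n.
- rewrite big_split /= sum_mem_sigma divfK // addrC -c_sum sum_option //.
- move: c_supp; rewrite inE inE => /andP[_].
  case: ifPn; last first.
    rewrite negbK => /eqP cN0 Kc; apply: (simplices_sub Kc); apply/subsetP => v.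
    by rewrite !inE /stellar_collapse cN0 !mul0r addr0.
  move=> cN Kc; apply: (simplices_sub Kc); apply/subsetP => v; rewrite !inE.
  rewrite /stellar_collapse; apply: contraNT; rewrite negb_or negbK.
  by case/andP => /eqP -> /negPf ->; rewrite mulr0 addr0.
Qed.

Lemma stellar_lift_realization x :
  realization R K x -> realization R stellar (stellar_lift x).
Proof.
move=> Kx; have [x_ge0 x_sum x_supp] := Kx.
have mu_ge0 := least_weight_ge0 Kx; split.
- case=> [v|] /=; last by rewrite mulr_ge0 ?ler0n.
  case: (boolP (v \in sigma)) => v_sigma; rewrite ?mulr1 ?mulr0 ?subr0 //.
  by rewrite subr_ge0 least_weight_le.
- rewrite sum_option /= sumrB sum_mem_sigma x_sum mulrC addrCA.
  by rewrite subrr addr0.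
- have [v v_sigma mu_v] := least_weightP Kx.
  rewrite inE; apply/andP; split.
    apply/subsetPn; exists v => //.
    by rewrite !inE /= -mu_v v_sigma mulr1 subrr eqxx.
  have lift_supp : Some @^-1: [set o | stellar_lift x o != 0]%SET
      \subset [set u | x u != 0]%SET.
    apply/subsetP => u; rewrite !inE /=; apply: contra => /eqP xu0.
    case: (boolP (u \in sigma)) => u_sigma; rewrite ?mulr0 ?subr0 ?xu0 //.
    by rewrite mulr1 sub0r oppr_eq0 eq_le mu_ge0 -[0]xu0 least_weight_le.
  case: ifPn; last by move=> _; exact: simplices_sub x_supp lift_supp.
  rewrite inE /= mulf_eq0 (negPf k_neq0) /= => mu_neq0.
  apply: simplices_sub x_supp _; rewrite subUset lift_supp.
  apply/subsetP => u u_sigma; rewrite inE gt_eqF //.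
  rewrite (lt_le_trans _ (least_weight_le _ u_sigma)) //.
  by rewrite lt_neqAle eq_sym mu_neq0.
Qed.

Lemma stellar_liftK : cancel stellar_lift stellar_collapse.
Proof.
move=> x; apply/funext => v.
by rewrite /stellar_collapse /= (mulrC k) mulfK // subrK.
Qed.

(** The old vertices supporting c do not include all of sigma, so some vertex of
    sigma owes all its weight to the new vertex. *)
Lemma least_weight_collapse c :
  realization R stellar c -> least_weight (stellar_collapse c) = c None / k.
Proof.
move=> Kc; have [c_ge0 _ ] := Kc; rewrite inE => /andP[/subsetPn[v v_sigma]].
rewrite !inE negbK => /eqP cv0 _.
have Kx := stellar_collapse_realization Kc.
apply/eqP; rewrite eq_le; apply/andP; split.
  apply: le_trans (least_weight_le _ v_sigma) _.
  by rewrite /stellar_collapse cv0 v_sigma mulr1 add0r.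
have [u u_sigma ->] := least_weightP Kx.
by rewrite /stellar_collapse u_sigma mulr1 lerDr.
Qed.

Lemma stellar_collapseK c :
  realization R stellar c -> stellar_lift (stellar_collapse c) = c.
Proof.
move=> Kc; apply/funext => -[v|] /=; rewrite least_weight_collapse //.
  by rewrite addrK.
by rewrite mulrC divfK.
Qed.

Lemma stellar_homeomorphic :
  homeomorphic (classical_sets.set_type (realization R stellar))
    (classical_sets.set_type (realization R K)).
Proof.
apply: (homeomorphic_set_type stellar_collapse_realization
  stellar_lift_realization stellar_collapseK (fun x _ => stellar_liftK x)) => x _.
- apply: continuous_ptws => v.
  rewrite /continuous_at /stellar_collapse.
  exact: (cvgD (@ptws_eval_continuous R _ (Some v) x)
    (cvgMr_tmp (cvgMr_tmp (@ptws_eval_continuous R _ None x)))).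
- have mu_cont : {for x, continuous (least_weight : {ptws V -> R} -> R^o)}.
    apply: (continuous_big (op := Order.min)) => [|v _].
      exact: min_continuous.
    exact: ptws_eval_continuous.
  apply: continuous_ptws => -[v|] /=.
    rewrite /continuous_at.
    exact: (cvgB (@ptws_eval_continuous R _ v x) (cvgMr_tmp mu_cont)).
  rewrite /continuous_at.
  exact: (cvgMl_tmp mu_cont).
Qed.

End StellarSubdivision.

(** * Independence over the field with two elements *)

Section SumsModTwo.
Local Open Scope ring_scope.
Variable n : nat.
Local Notation W := 'rV['F_2]_n.

Lemma F2_neq0 (a : 'F_2) : a != 0 -> a = 1.
Proof. by move=> a_neq0; apply/val_inj; case: a a_neq0 => -[|[|[]]]. Qed.

Lemma addrr_F2 (x : W) : x + x = 0.
Proof. by rewrite -mulr2n -scaler_nat (_ : 2%:R = 0) ?scale0r //; exact/val_inj. Qed.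

Lemma addr_eq0_F2 (x y : W) : (x + y == 0) = (x == y).
Proof. by rewrite -(inj_eq (addIr y)) -addrA addrr_F2 addr0 add0r. Qed.

Lemma sum_symdiff (V : finType) (f : V -> W) (A B : {set V}) :
  \sum_(v in A) f v + \sum_(v in B) f v = \sum_(v in (A :\: B) :|: (B :\: A)) f v.
Proof.
rewrite (big_setID B) [X in _ + X](big_setID A) (setIC B A) /=.
rewrite addrACA addrr_F2 add0r -bigU /=; last first.
  rewrite -setI_eq0; apply/eqP/setP => v; rewrite !inE.
  by case: (v \in A); rewrite ?andbF.
by apply: eq_bigl => v; rewrite !inE.
Qed.

Lemma free_enumP (t : {set W}) :
  free (enum t) <->
  (forall c : W -> 'F_2, \sum_(x in t) c x *: x = 0 -> {in t, forall x, c x = 0}).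
Proof.
pose X := in_tuple (enum t).
have sumX (c : W -> 'F_2) : \sum_(i < size (enum t)) c X`_i *: X`_i
    = \sum_(x in t) c x *: x.
  by rewrite -[RHS]big_enum /= (big_nth 0) big_mkord.
split=> [/(@freeP _ _ _ X) X_free c c0 x xt|t_indep].
  have /(nthP 0)[i i_lt <-] : x \in enum t by rewrite mem_enum.
  by apply: (X_free (fun i => c X`_i) _ (Ordinal i_lt)); rewrite sumX.
apply/(@freeP _ _ _ X) => k k0 i.
pose c x := if insub (index x (enum t)) is Some j then k j else 0.
have cX (j : 'I_(size (enum t))) : c X`_j = k j.
  by rewrite /c /= index_uniq ?enum_uniq // insubT //= => jlt; congr k; exact/val_inj.
rewrite -cX; apply: t_indep; last by rewrite -mem_enum mem_nth.
by rewrite -sumX -[RHS]k0; apply: eq_bigr => j _; rewrite cX.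
Qed.

(** Coefficients are 0 or 1, so linear combinations are sums over subsets. *)
Lemma mem_XZ2 (t : {set W}) :
  (t \in simplices (XZ2 n)) <->
  (forall J : {set W}, J \subset t -> J != set0 -> \sum_(x in J) x != 0).
Proof.
have restrict (J : {set W}) (c : W -> 'F_2) : J \subset t ->
    {in t, forall x, c x = (x \in J)%:R} ->
    \sum_(x in t) c x *: x = \sum_(x in J) x.
  move=> Jt cJ; rewrite [RHS]big_mkcond [LHS]big_mkcond.
  apply: eq_bigr => x _ /=; case: ifP => [xt|/negbT xNt].
    by rewrite cJ //; case: (x \in J); rewrite ?scale1r ?scale0r.
  by rewrite ifN // (contra (subsetP Jt x)).
rewrite inE; split=> [/free_enumP t_indep J Jt /set0Pn[x xJ]|t_indep].
  apply/eqP => J0; have := t_indep (fun x => (x \in J)%:R).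
  rewrite (restrict J) // => /(_ J0 x (subsetP Jt x xJ)).
  by rewrite xJ => /eqP; rewrite oner_eq0.
apply/free_enumP => c c0 x xt; apply/eqP; apply: contraT => cx_neq0.
pose J := [set y in t | c y != 0].
have Jt : J \subset t by apply/subsetP => y; rewrite inE => /andP[].
have: \sum_(x in J) x != 0.
  by apply: t_indep => //; apply/set0Pn; exists x; rewrite inE xt.
rewrite -(restrict J c) ?c0 ?eqxx // => y yt.
by rewrite inE yt; have [->//|/F2_neq0] := eqVneq (c y) 0.
Qed.

End SumsModTwo.

(** * Labellings *)

Section Labellings.
Local Open Scope ring_scope.
Variables (n : nat) (V : finType) (K : simplicial_complex V).
Local Notation W := 'rV['F_2]_n.

(** A concise form of being a nondegenerate simplicial map to X(Z_2^n): as all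
    faces of a simplex are simplices, it forbids every linear relation between
    the labels of a simplex, the relation x + x = 0 of equal labels included. *)
Definition labelling (f : V -> W) : Prop :=
  forall s : {set V}, s \in simplices K -> s != set0 -> \sum_(v in s) f v != 0.

Variable f : V -> W.
Hypothesis f_lab : labelling f.

Lemma labelling_inj : nondegenerate_map K f.
Proof.
move=> s Ks u v us vs fuv; apply/eqP; apply: contraT => uv.
have: \sum_(x in [set u; v]) f x != 0.
  apply: f_lab; last by apply/set0Pn; exists u; rewrite set21.
  by apply: (simplices_sub Ks); rewrite subUset !sub1set us.
by rewrite big_setU1 ?inE // big_set1 fuv /= addrr_F2 eqxx.
Qed.

Lemma labelling_simplicial : simplicial_map K (XZ2 n) f.
Proof.
move=> s Ks; apply/mem_XZ2 => J Js J_neq0.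
pose I := s :&: f @^-1: J.
have f_inj : {in I &, injective f}.
  by move=> u v; rewrite !inE => /andP[us _] /andP[vs _]; exact: labelling_inj us vs.
have <- : f @: I = J.
  apply/setP => x; apply/imsetP/idP => [[v + ->]|xJ].
    by rewrite !inE => /andP[].
  have /imsetP[v vs xv] := subsetP Js x xJ.
  by exists v; rewrite // !inE vs -xv.
rewrite big_imset //; apply: f_lab.
  exact: simplices_sub Ks (subsetIl _ _).
have /set0Pn[x xJ] := J_neq0; have /imsetP[v vs xv] := subsetP Js x xJ.
by apply/set0Pn; exists v; rewrite !inE vs -xv.
Qed.

(** Distinct subsets of s have distinct label sums, because the sum over their
    symmetric difference is nonzero; there are 2^n subsets and 2^n vectors. *)
Lemma labelling_spans (s : {set V}) (x : W) :
  s \in simplices K -> #|s| = n ->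
  exists2 I : {set V}, I \subset s & x = \sum_(v in I) f v.
Proof.
move=> Ks s_card.
pose sums := [set \sum_(v in I) f v | I : {set V} in powerset s].
suff: x \in sums by case/imsetP => I; rewrite powersetE; exists I.
suff -> : sums = setT by rewrite inE.
apply/eqP; rewrite eqEcard subsetT cardsT card_mx card_Fp // mul1n.
rewrite card_in_imset ?card_powerset ?s_card ?leqnn //= => I J.
rewrite !powersetE => Is Js /eqP; rewrite -addr_eq0_F2 sum_symdiff => IJ0.
have: (I :\: J) :|: (J :\: I) == set0.
  apply: contraTT IJ0; apply: f_lab; apply: (simplices_sub Ks).
  by rewrite subUset !subDset !subsetU ?Is ?Js ?orbT.
by rewrite setU_eq0 !setD_eq0 => /andP[IJ JI]; apply/eqP; rewrite eqEsubset IJ.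
Qed.

(** The bases reached by a labelling. Subdividing at a simplex destroys the
    simplices containing it, so the restriction to n-element simplices, which
    are maximal, is what lets a subdivision at one of them spare the others. *)
Definition full_images : {set {set W}} :=
  [set f @: s | s : {set V} in [set s in simplices K | #|s| == n]].

Lemma full_imagesP (t : {set W}) :
  reflect (exists s : {set V}, [/\ s \in simplices K, #|s| = n & t = f @: s])
    (t \in full_images).
Proof.
apply: (iffP imsetP) => [[s]|[s [Ks s_card ->]]].
  by rewrite inE => /andP[Ks /eqP s_card] ->; exists s.
by exists s; rewrite ?inE ?Ks ?s_card ?eqxx.
Qed.

End Labellings.
Arguments labelling {n V}.
Arguments full_images {n V}.

(** * Labellings of stellar subdivisions *)

Section StellarLabels.
Local Open Scope ring_scope.
Variables (n : nat) (V : finType) (K : simplicial_complex V) (sigma : {set V}).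
Hypothesis sigma_neq0 : sigma != set0.
Variable f : V -> 'rV['F_2]_n.

Definition stellar_label (o : option V) : 'rV['F_2]_n :=
  if o is Some v then f v else \sum_(v in sigma) f v.

Lemma stellar_label_imset (s : {set V}) : stellar_label @: (Some @: s) = f @: s.
Proof. by rewrite -imset_comp; exact: eq_imset. Qed.

Lemma sum_stellar_label (s : {set V}) :
  \sum_(o in Some @: s) stellar_label o = \sum_(v in s) f v.
Proof. by rewrite big_imset //= => ? ? _ _ []. Qed.

(** Over Z_2 the label sum of a simplex through the new vertex is the sum over
    the symmetric difference of sigma and the old part t of that simplex. It is
    nonempty as t does not contain sigma, and it lies in a simplex of K. *)
Lemma stellar_labelling :
  labelling K f -> labelling (stellar K sigma_neq0) stellar_label.
Proof.
move=> f_lab s; rewrite inE => /andP[sNsigma Ks] s_neq0.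
set t := Some @^-1: s in sNsigma Ks.
have s_def : s :\ None = Some @: t.
  apply/setP => -[v|]; rewrite !inE ?None_notin_imset //=.
  by rewrite mem_imset ?inE // => ? ? [].
case: ifPn Ks => sN Kt.
  rewrite (big_setD1 None) //= s_def sum_stellar_label sum_symdiff.
  apply: f_lab.
    apply: (simplices_sub Kt); rewrite setUC.
    by rewrite setUSS // subDset subsetU // subxx orbT.
  have /subsetPn[v v_sigma vNt] := sNsigma.
  by apply/set0Pn; exists v; rewrite in_setU !in_setD vNt v_sigma.
have s_t : s = Some @: t.
  rewrite -s_def; apply/setP => o; rewrite !inE.
  by have [->|] := eqVneq o None; rewrite ?(negPf sN).
rewrite s_t sum_stellar_label; apply: f_lab => //.
by apply: contraNneq s_neq0 => t0; rewrite s_t t0 imset0.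
Qed.

End StellarLabels.

(** * Reaching every basis *)

Section LabelledSpheres.
Local Open Scope ring_scope.
Variables (R : realType) (d n : nat).
Local Notation W := 'rV['F_2]_n.

Record labelled_sphere := LabelledSphere {
  sphere_verts : finType;
  sphere_complex :> simplicial_complex sphere_verts;
  label : sphere_verts -> W;
  sphereP : simplicial_sphere R d sphere_complex;
  labelP : labelling sphere_complex label }.

Definition sphere_images (X : labelled_sphere) : {set {set W}} :=
  full_images (sphere_complex X) (@label X).

Lemma stellar_sphere (V : finType) (K : simplicial_complex V) (sigma : {set V})
    (sigma_neq0 : sigma != set0) :
  simplicial_sphere R d K -> simplicial_sphere R d (stellar K sigma_neq0).
Proof. exact: homeomorphic_trans (stellar_homeomorphic _ _ _). Qed.

Definition subdivide (X : labelled_sphere) (sigma : {set sphere_verts X})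
    (sigma_neq0 : sigma != set0) : labelled_sphere :=
  LabelledSphere (stellar_sphere sigma_neq0 (@sphereP X))
    (stellar_labelling (sigma_neq0 := sigma_neq0) (@labelP X)).

Lemma NoneU_neq0 (T : finType) (A : {set option T}) : None |: A != set0.
Proof. by apply/set0Pn; exists None; exact: setU11. Qed.

Lemma NoneU_D1 (T : finType) (A : {set T}) : (None |: Some @: A) :\ None = Some @: A.
Proof. by rewrite setU1K // None_notin_imset. Qed.

Lemma card_NoneU (T : finType) (A : {set T}) : #|None |: Some @: A| = #|A|.+1.
Proof. by rewrite cardsU1 None_notin_imset card_imset // => ? ? []. Qed.

Lemma subset_NoneU (T : finType) (A B : {set T}) :
  A \subset B -> None |: Some @: A \subset None |: Some @: B.
Proof. by move=> AB; exact/setUS/imsetS. Qed.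

Lemma mem_Some (T : finType) (A : {set T}) x : (Some x \in Some @: A) = (x \in A).
Proof. by rewrite mem_imset // => ? ? []. Qed.

(** The three subdivisions take place inside s: the first destroys no other
    simplex with n vertices, and the next two are at simplices that contain the
    vertex created just before. *)
Lemma add_exchanged_basis (X : labelled_sphere) (s I : {set sphere_verts X})
    (a b : sphere_verts X) :
  s \in simplices X -> #|s| = n -> I \subset s -> a \in I -> b \in I -> a != b ->
  exists2 Y : labelled_sphere, sphere_images X \subset sphere_images Y &
    (\sum_(v in I) label v) |: (@label X @: (s :\ b)) \in sphere_images Y.
Proof.
move=> Xs s_card Is aI bI ab.
have as_ := subsetP Is a aI; have bs := subsetP Is b bI.
have s_neq0 : s != set0 by apply/set0Pn; exists a.
pose X1 := subdivide s_neq0.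
pose sigma2 : {set sphere_verts X1} := None |: Some @: (s :\: I).
pose X2 := @subdivide X1 sigma2 (NoneU_neq0 _).
pose sigma3 : {set sphere_verts X2} := None |: Some @: (Some @: (I :\ a)).
pose X3 := @subdivide X2 sigma3 (NoneU_neq0 _).
have label2 : @label X2 None = \sum_(v in I) label v.
  rewrite /= big_setU1 ?None_notin_imset //= sum_stellar_label.
  by rewrite (big_setID I) /= (setIidPr Is) -addrA addrr_F2 addr0.
have label3 : @label X3 None = label a.
  have -> : @label X3 None = @label X2 None + \sum_(v in I :\ a) label v.
    by rewrite [LHS]/= big_setU1 ?None_notin_imset // !sum_stellar_label.
  rewrite label2 (big_setD1 a) //=.
  by rewrite -addrA addrr_F2 addr0.
(* The sides of s are now coned off by the new vertex. *)
have side1 v : v \in I -> None |: Some @: (s :\ v) \in simplices X1.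
  by move=> vI; apply: stellar_new => //; exact: subsetP Is v vI.
have side2 v : v \in I ->
    None |: Some @: (Some @: (s :\ v)) \in simplices X2.
  move=> vI; rewrite -(NoneU_D1 (s :\ v)).
  apply: stellar_new; [exact: side1| |exact: setU11].
  apply: subset_NoneU; apply/subsetP => u; rewrite !inE => /andP[uNI ->].
  by rewrite andbT; apply: contraNneq uNI => ->.
have old3 (r : {set sphere_verts X2}) : r \in simplices X2 ->
    ~~ (sigma3 \subset r) -> Some @: r \in simplices X3.
  exact: stellar_old.
(* This simplex has the labels of s. *)
have new3 : None |: Some @: (Some @: (Some @: (s :\ a))) \in simplices X3.
  rewrite -(NoneU_D1 (Some @: (s :\ a))).
  apply: stellar_new; [exact: side2| |exact: setU11].
  exact/subset_NoneU/imsetS/setSD.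
exists X3.
  apply/subsetP => t /full_imagesP[r [Xr r_card ->]]; apply/full_imagesP.
  have [->|rNs] := eqVneq r s.
    exists (None |: Some @: (Some @: (Some @: (s :\ a)))); split=> //.
      rewrite card_NoneU card_imset ?card_imset; try by move=> ? ? [].
      by rewrite -s_card (cardsD1 a s) as_.
    by rewrite imsetU1 label3 !stellar_label_imset -imsetU1 setD1K //.
  exists (Some @: (Some @: (Some @: r))); split.
  - apply: old3; last first.
      by apply/subsetPn; exists None; rewrite ?setU11 ?None_notin_imset.
    apply: stellar_old; last first.
      by apply/subsetPn; exists None; rewrite ?setU11 ?None_notin_imset.
    apply: stellar_old => //; apply: contra rNs => sr.
    by rewrite eq_sym eqEcard sr s_card r_card leqnn.
  - by rewrite !card_imset //; move=> ? ? [].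
  - by rewrite !stellar_label_imset.
(* The exchanged basis, created by the second subdivision, outlives the third
   because b belongs to I minus a. *)
apply/full_imagesP; exists (Some @: (None |: Some @: (Some @: (s :\ b)))); split.
- apply: old3; first exact: side2.
  apply/subsetPn; exists (Some (Some b)).
    by rewrite !inE /= !mem_Some !inE eq_sym ab bI.
  by rewrite !inE /= !mem_Some !inE eqxx.
- rewrite card_imset ?card_NoneU ?card_imset; try by move=> ? ? [].
  by rewrite -s_card (cardsD1 b s) bs.
- by rewrite stellar_label_imset imsetU1 label2 !stellar_label_imset.
Qed.

(** Steinitz exchange. If x in T is not in t, write x as a sum of elements of t.
    Since T is independent, one of them is outside T; trading it for x
    brings t closer to T. *)
Lemma cover_facet (T : {set W}) (X : labelled_sphere) (t : {set W}) :
  facet (XZ2 n) T -> t \in sphere_images X ->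
  exists2 Y : labelled_sphere, sphere_images X \subset sphere_images Y &
    T \in sphere_images Y.
Proof.
move=> T_facet; have [m] := ubnP #|T :\: t|; elim: m => // m IHm in X t *.
rewrite ltnS => Tt_card Xt.
have /maxsetP[/mem_XZ2 T_indep T_max] := T_facet.
have [s [Xs s_card t_s]] := full_imagesP _ _ _ Xt.
have [Tt|] := boolP (T \subset t).
  exists X => //; rewrite -(T_max t _ Tt) // t_s.
  exact: labelling_simplicial (@labelP X) _ Xs.
case/subsetPn => x xT xNt.
have [I Is x_sum] := labelling_spans (@labelP X) x Xs s_card.
have label_inj : {in I &, injective (@label X)}.
  by move=> u v uI vI; apply: (labelling_inj (@labelP X) Xs); exact: subsetP Is _ _.
(* Otherwise x would be a sum of other elements of T. *)
have [b bI fbNT] : exists2 b, b \in I & label b \notin T.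
  apply/exists_inP; apply: contraT; rewrite negb_exists_in => /forall_inP IT.
  have xNI : x \notin @label X @: I.
    by apply: contra xNt; rewrite t_s; exact/subsetP/imsetS.
  have := T_indep (x |: @label X @: I).
  rewrite big_setU1 //= big_imset //= -x_sum addrr_F2 eqxx; apply.
    rewrite subUset sub1set xT; apply/subsetP => _ /imsetP[v vI ->].
    by have := IT v vI; rewrite negbK.
  by apply/set0Pn; exists x; exact: setU11.
(* Otherwise x would itself be a label of s. *)
have [a aI ab] : exists2 a, a \in I & a != b.
  apply/exists_inP; apply: contraT; rewrite negb_exists_in => /forall_inP Ib.
  have I_b : I = [set b].
    apply/setP => v; rewrite inE; apply/idP/eqP => [vI|->//].
    by apply/eqP; have := Ib v vI; rewrite negbK.
  case/negP: xNt; rewrite x_sum I_b big_set1 t_s imset_f //.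
  exact: subsetP Is b bI.
have [Y XY Yt'] := add_exchanged_basis Xs s_card Is aI bI ab.
have [|Z YZ ZT] := IHm Y _ _ Yt'; last by exists Z; rewrite // (subset_trans XY).
apply: leq_trans (proper_card _) Tt_card; apply/properP; split.
  apply/subsetP => y; rewrite !in_setD in_setU1 negb_or => /andP[/andP[_ yNt'] yT].
  rewrite yT andbT t_s; apply: contra yNt' => /imsetP[v vs yv].
  rewrite yv imset_f // in_setD1 vs andbT; apply: contraNneq fbNT => <-.
  by rewrite -yv.
exists x; first by rewrite in_setD xNt.
by rewrite in_setD in_setU1 x_sum eqxx.
Qed.

Lemma cover_all_facets (X : labelled_sphere) :
  sphere_images X != set0 ->
  exists Y : labelled_sphere, forall T, facet (XZ2 n) T -> T \in sphere_images Y.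
Proof.
case/set0Pn => t Xt.
suff [Y _ YT] : exists2 Y : labelled_sphere, t \in sphere_images Y &
    forall T, T \in enum (facet (XZ2 n)) -> T \in sphere_images Y.
  by exists Y => T T_facet; apply: YT; rewrite mem_enum.
have: {subset enum (facet (XZ2 n)) <= facet (XZ2 n)}.
  by move=> T; rewrite mem_enum.
elim: (enum _) => [|T Ts IHTs] Ts_facets; first by exists X.
have [|Y Yt YTs] := IHTs.
  by move=> U UTs; apply: Ts_facets; rewrite in_cons UTs orbT.
have [Z YZ ZT] := cover_facet (Ts_facets T (mem_head _ _)) Yt.
exists Z; first exact: subsetP YZ t Yt.
by move=> U; rewrite in_cons => /predU1P[->//|/YTs]; exact: subsetP YZ U.
Qed.

(** A simplex r containing s has an independent image containing T, hence equal
    to T; as r is mapped injectively, r = s. *)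
Lemma facet_of_full_image (Y : labelled_sphere) (T : {set W}) :
  facet (XZ2 n) T -> T \in sphere_images Y ->
  exists2 s : {set sphere_verts Y}, facet Y s & @label Y @: s = T.
Proof.
move=> T_facet /full_imagesP[s [Ys _ T_s]]; exists s => //.
have /maxsetP[_ T_max] := T_facet.
apply/maxsetP; split=> // r Yr sr; apply/eqP; rewrite eqEsubset sr andbT.
have rs : @label Y @: r = @label Y @: s.
  rewrite -T_s; apply: T_max; first exact: labelling_simplicial (@labelP Y) _ Yr.
  by rewrite T_s imsetS.
apply/subsetP => v vr; have: label v \in @label Y @: s by rewrite -rs imset_f.
case/imsetP => u us /(labelling_inj (@labelP Y) Yr vr) -> //.
exact: subsetP sr u us.
Qed.

End LabelledSpheres.

(** * The boundary of the cross-polytope *)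

Section CrossPolytope.
Local Open Scope ring_scope.
Variable n : nat.
Local Notation V := ('I_n.+1 * bool)%type.

(** The vertex (i, b) is e_i or -e_i according to b; a set of vertices spans a
    face unless it contains an antipodal pair. *)
Definition cross_simplices : {set {set V}} :=
  [set s : {set V} | [forall i, ((i, true) \in s) ==> ((i, false) \notin s)]].

Lemma cross_simplices0 : set0 \in cross_simplices.
Proof. by rewrite inE; apply/forallP => i; rewrite !inE. Qed.

Lemma cross_simplices_sub (s t : {set V}) :
  s \in cross_simplices -> t \subset s -> t \in cross_simplices.
Proof.
rewrite !inE => /forallP s_cross ts; apply/forallP => i; apply/implyP => it.
have := s_cross i; rewrite (subsetP ts _ it) /=.
exact/contra/(subsetP ts).
Qed.

Definition cross_polytope : simplicial_complex V :=
  SimplicialComplex cross_simplices0 cross_simplices_sub.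

Lemma cross_opposite (s : {set V}) i b :
  s \in simplices cross_polytope -> (i, b) \in s -> (i, ~~ b) \notin s.
Proof.
rewrite inE => /forallP/(_ i) + ib; case: b ib => [-> //|ib].
by rewrite ib implybF.
Qed.

Definition cross_label (v : V) : 'rV['F_2]_n.+1 := delta_mx ord0 v.1.

(** For a vertex (i, b) of a simplex, no other vertex contributes to the i-th
    coordinate of the sum. *)
Lemma cross_labelling : labelling cross_polytope cross_label.
Proof.
move=> s Ks /set0Pn[[i b] ib].
apply/eqP => /rowP/(_ i); rewrite summxE (bigD1 (i, b)) //= big1 => [|v].
  by rewrite !mxE !eqxx addr0 => /eqP; rewrite oner_eq0.
case: v => j c /andP[jc jcNib]; rewrite mxE /=.
have [ij|] := eqVneq i j; last by rewrite ?andbF.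
move: jc jcNib; rewrite -ij xpair_eqE eqxx /= => ic cNb.
by have := cross_opposite Ks ib; rewrite -(_ : c = ~~ b) ?ic //;
  case: b c cNb {ib ic} => -[].
Qed.

Lemma cross_full_images_neq0 : full_images cross_polytope cross_label != set0.
Proof.
pose s : {set V} := [set (i, true) | i in 'I_n.+1].
apply/set0Pn; exists (cross_label @: s); apply/full_imagesP; exists s; split=> //.
  rewrite inE; apply/forallP => i; apply/implyP => _.
  by apply/imsetP => -[].
by rewrite card_imset ?card_ord // => i j [].
Qed.

Variable R : realType.
Local Notation E := 'rV[R]_n.+1.

Definition signed_coords (x : {ptws V -> R}) : E :=
  \row_i (x (i, true) - x (i, false)).

Definition l1_norm (y : E) : R := \sum_i `|y ord0 i|.
Definition l2_norm (y : E) : R := Num.sqrt (\sum_i y ord0 i ^+ 2).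

Definition signed_part (b : bool) (r : R) : R := Num.max (if b then r else - r) 0.

(** The radial projection between the unit spheres of the l1 and l2 norms. *)
Definition to_sphere (x : {ptws V -> R}) : E :=
  (l2_norm (signed_coords x))^-1 *: signed_coords x.

Definition of_sphere (y : E) : {ptws V -> R} :=
  fun v => signed_part v.2 (y ord0 v.1) / l1_norm y.

Lemma sum_signed (F : V -> R) : \sum_v F v = \sum_i (F (i, true) + F (i, false)).
Proof.
rewrite (eq_bigr (fun v => F (v.1, v.2))) => [|[] //].
rewrite -(pair_bigA _ (fun i b => F (i, b))) /=.
by apply: eq_bigr => i _; rewrite big_bool.
Qed.

Lemma signed_part_sum r : signed_part true r + signed_part false r = `|r|.
Proof.
rewrite /signed_part; have [r_ge0|r_lt0] := leP 0 r.
  by rewrite max_r ?oppr_le0 // addr0 ger0_norm.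
by rewrite max_l ?oppr_ge0 ?(ltW r_lt0) // add0r ltr0_norm.
Qed.

Lemma signed_part_sub r : signed_part true r - signed_part false r = r.
Proof.
rewrite /signed_part; have [r_ge0|r_lt0] := leP 0 r.
  by rewrite max_r ?oppr_le0 // subr0.
by rewrite max_l ?oppr_ge0 ?(ltW r_lt0) // sub0r opprK.
Qed.

Lemma signed_partZ b (c r : R) : 0 <= c -> signed_part b (c * r) = c * signed_part b r.
Proof.
by move=> c_ge0; rewrite /signed_part maxr_pMr // mulr0; case: b; rewrite ?mulrN.
Qed.

Lemma l1_normZ (c : R) y : 0 <= c -> l1_norm (c *: y) = c * l1_norm y.
Proof.
move=> c_ge0; rewrite /l1_norm mulr_sumr; apply: eq_bigr => i _.
by rewrite mxE normrM ger0_norm.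
Qed.

Lemma l2_normZ (c : R) y : 0 <= c -> l2_norm (c *: y) = c * l2_norm y.
Proof.
move=> c_ge0; rewrite /l2_norm.
under eq_bigr do rewrite mxE exprMn.
by rewrite -mulr_sumr sqrtrM ?sqr_ge0 // sqrtr_sqr ger0_norm.
Qed.

Lemma sqr_l2_norm y : l2_norm y ^+ 2 = \sum_i y ord0 i ^+ 2.
Proof. by rewrite sqr_sqrtr // sumr_ge0 // => i _; exact: sqr_ge0. Qed.

Lemma norm_gt0 y : y != 0 -> 0 < l1_norm y /\ 0 < l2_norm y.
Proof.
case/matrix0Pn => i [j]; rewrite (ord1 i) => yj.
split; [rewrite /l1_norm|rewrite sqrtr_gt0]; rewrite (bigD1 j) //= ltr_wpDr //.
- by apply: sumr_ge0.
- by rewrite normr_gt0.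
- by apply: sumr_ge0 => k _; exact: sqr_ge0.
- by rewrite exprn_even_gt0 //= yj orbT.
Qed.

Lemma sphere_neq0 y : sphere R n y -> y != 0.
Proof.
rewrite /sphere /= => y1; apply/eqP => y0; move: y1; rewrite y0 big1 => [|i _].
  by move/eqP; rewrite eq_sym oner_eq0.
by rewrite mxE expr0n.
Qed.

Lemma l2_norm_sphere y : sphere R n y -> l2_norm y = 1.
Proof. by move=> y1; rewrite /l2_norm y1 sqrtr1. Qed.

Section Points.
Variable x : {ptws V -> R}.
Hypothesis Kx : realization R cross_polytope x.

(** One of the two opposite weights vanishes, so their difference determines
    both. *)
Lemma signed_part_coords i b :
  signed_part b (signed_coords x ord0 i) = x (i, b).
Proof.
have [x_ge0 _ x_supp] := Kx; rewrite mxE.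
have x0 : x (i, true) = 0 \/ x (i, false) = 0.
  have [->|xi] := eqVneq (x (i, true)) 0; [by left|right].
  have := @cross_opposite _ i true x_supp; rewrite !inE xi => /(_ isT).
  by rewrite negbK => /eqP.
rewrite /signed_part; case: b; case: x0 => ->.
- by rewrite sub0r max_r ?oppr_le0.
- by rewrite subr0 max_l.
- by rewrite sub0r opprK max_l.
- by rewrite subr0 max_r ?oppr_le0.
Qed.

Lemma l1_signed_coords : l1_norm (signed_coords x) = 1.
Proof.
have [_ <- _] := Kx; rewrite sum_signed; apply: eq_bigr => i _.
by rewrite -signed_part_sum !signed_part_coords.
Qed.

Lemma signed_coords_neq0 : signed_coords x != 0.
Proof.
apply/eqP => x0; have := l1_signed_coords; rewrite x0 /l1_norm big1 => [|i _].
  by move/eqP; rewrite eq_sym oner_eq0.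
by rewrite mxE normr0.
Qed.

Lemma to_sphereP : sphere R n (to_sphere x).
Proof.
have [_ l2_gt0] := norm_gt0 signed_coords_neq0.
rewrite /sphere /= -sqr_l2_norm l2_normZ ?invr_ge0 ?ltW //.
by rewrite mulVf ?expr1n // gt_eqF.
Qed.

Lemma to_sphereK : of_sphere (to_sphere x) = x.
Proof.
have [_ l2_gt0] := norm_gt0 signed_coords_neq0.
have c_ge0 : 0 <= (l2_norm (signed_coords x))^-1 by rewrite invr_ge0 ltW.
apply/funext => -[i b]; rewrite /of_sphere /to_sphere l1_normZ // mxE /=.
rewrite signed_partZ // signed_part_coords l1_signed_coords mulr1.
by rewrite invrK mulrAC mulVf ?mul1r // gt_eqF.
Qed.

End Points.

Lemma signed_coords_of_sphere y :
  signed_coords (of_sphere y) = (l1_norm y)^-1 *: y.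
Proof.
by apply/rowP => i; rewrite !mxE /of_sphere /= -mulrBl signed_part_sub mulrC.
Qed.

Lemma of_sphereK y : sphere R n y -> to_sphere (of_sphere y) = y.
Proof.
move=> y1; have [l1_gt0 _] := norm_gt0 (sphere_neq0 y1).
rewrite /to_sphere signed_coords_of_sphere l2_normZ ?invr_ge0 ?ltW //.
by rewrite l2_norm_sphere // mulr1 invrK scalerA mulfV ?scale1r // gt_eqF.
Qed.

Lemma of_sphereP y : sphere R n y -> realization R cross_polytope (of_sphere y).
Proof.
move=> y1; have [l1_gt0 _] := norm_gt0 (sphere_neq0 y1); split.
- by move=> v; rewrite divr_ge0 ?(ltW l1_gt0) // /signed_part le_max lexx orbT.
- rewrite sum_signed /of_sphere /=.
  under eq_bigr do rewrite -mulrDl signed_part_sum.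
  by rewrite -mulr_suml divff // gt_eqF.
- rewrite inE; apply/forallP => i; apply/implyP; rewrite !inE negbK.
  rewrite /of_sphere /= /signed_part; have [yi|yi] := leP (y ord0 i) 0.
    by rewrite mul0r eqxx.
  by rewrite max_r ?oppr_le0 ?ltW // mul0r.
Qed.

Lemma signed_coords_continuous : continuous signed_coords.
Proof.
move=> x; apply: continuous_rV => j.
rewrite (_ : (fun _ => _) = fun z : {ptws V -> R} => z (j, true) - z (j, false)).
  exact: (cvgB (@ptws_eval_continuous R _ (j, true) x)
               (@ptws_eval_continuous R _ (j, false) x)).
by apply/funext => z; rewrite mxE.
Qed.

Lemma l1_norm_continuous : continuous (l1_norm : E -> R^o).
Proof.
apply: continuous_big => [|i _ y]; first exact: add_continuous.
exact: (cvg_norm (@coord_continuous R _ _ ord0 i y)).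
Qed.

Lemma l2_norm_continuous : continuous (l2_norm : E -> R^o).
Proof.
move=> y; apply: (continuous_comp _ (@sqrt_continuous R _)).
apply: continuous_big => [|i _ z]; first exact: add_continuous.
exact: (cvgM (@coord_continuous _ _ _ ord0 i z) (@coord_continuous _ _ _ ord0 i z)).
Qed.

Lemma cross_polytope_sphere : simplicial_sphere R n cross_polytope.
Proof.
apply: (homeomorphic_set_type to_sphereP of_sphereP to_sphereK of_sphereK).
- move=> x /set_mem Kx.
  have [_ l2_gt0] := norm_gt0 (signed_coords_neq0 Kx).
  have c_cont := @signed_coords_continuous x.
  rewrite /continuous_at.
  apply: (cvgZ (cvgV _ (continuous_comp c_cont (@l2_norm_continuous _))) c_cont).
  by rewrite gt_eqF.
- move=> y /set_mem y1; have [l1_gt0 _] := norm_gt0 (sphere_neq0 y1).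
  apply: continuous_ptws => -[i b]; rewrite /continuous_at.
  have y_cont := @coord_continuous R _ _ ord0 i y.
  have part_cont : {for y, continuous (fun z : E => signed_part b (z ord0 i) : R^o)}.
    apply: continuous_max; last by apply: cst_continuous.
    by case: b; last exact: (cvgN y_cont).
  exact: (cvgM part_cont (cvgV (lt0r_neq0 l1_gt0) (@l1_norm_continuous y))).
Qed.

End CrossPolytope.

(** * Surjectivity on facets *)

Theorem proposition5p4 (R : realType) :
  exists (V : finType) (K : simplicial_complex V) (f : V -> 'rV['F_2]_4),
    [/\ simplicial_sphere R 3 K,
        simplicial_map K (XZ2 4) f,
        nondegenerate_map K f &
        surjective_on_facets K (XZ2 4) f].
Proof.
pose X0 := LabelledSphere (cross_polytope_sphere 3 R) (@cross_labelling 3).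
have [Y Y_covers] := @cover_all_facets R 3 4 X0 (@cross_full_images_neq0 3).
exists (sphere_verts Y), Y, (@label _ _ _ Y); split.
- exact: sphereP.
- exact: labelling_simplicial (@labelP _ _ _ Y).
- exact: labelling_inj (@labelP _ _ _ Y).
- by move=> T T_facet; exact/facet_of_full_image/Y_covers.
Qed.
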